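(* Let $T_n$ be a tree on $n$ vertices. Then for every real $p$ with $0<p<2$, $$\mathcal{E}_{p}(S_n) \leq \mathcal{E}_{p}(T_n)\leq \mathcal{E}_{p}(P_n).$$
   Context: Graphs are finite, simple and undirected. $S_n$ denotes the star on $n$ vertices (one central vertex adjacent to each of the other $n-1$ vertices, with no other edges), and $P_n$ denotes the path on $n$ vertices. For a graph $G$ on $n$ vertices with adjacency matrix $A_G$ having eigenvalues $\lambda_1,\dots,\lambda_n$ (real, listed with multiplicity), the $p$-Schatten energy of $G$ is $\mathcal{E}_p(G)=\sum_{j=1}^n|\lambda_j|^p$ (for $p>0$, with $0^p=0$). *)

(* Defs.v *)
From mathcomp Require Import all_boot all_order all_algebra.
From mathcomp Require Import spectral sesquilinear polyrcf complex.
From mathcomp Require Import reals exp.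

Set Implicit Arguments.
Unset Strict Implicit.
Unset Printing Implicit Defensive.

Import Order.TTheory GRing.Theory Num.Theory.

Record sgraph (T : finType) := SGraph {
  adj :> rel T;
  adj_sym : symmetric adj;
  adj_irr : irreflexive adj }.

Definition connected_graph (T : finType) (G : sgraph T) : Prop :=
  forall x y : T, connect G x y.

(* The bound on the size is needed: for an edge xy, [:: x; y] is a ucycle. *)
Definition acyclic_graph (T : finType) (G : sgraph T) : Prop :=
  forall c : seq T, ucycle G c -> (size c < 3)%N.

Definition is_tree (T : finType) (G : sgraph T) : Prop :=
  [/\ (0 < #|T|)%N, connected_graph G & acyclic_graph G].

Definition star_rel n : rel 'I_n :=
  fun i j => (i != j) && ((i == 0 :> nat) || (j == 0 :> nat)).

Lemma star_sym n : symmetric (@star_rel n).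
Proof. by move=> i j; rewrite /star_rel eq_sym orbC. Qed.

Lemma star_irr n : irreflexive (@star_rel n).
Proof. by move=> i; rewrite /star_rel eqxx. Qed.

Definition star_graph n : sgraph 'I_n := SGraph (@star_sym n) (@star_irr n).

Definition path_rel n : rel 'I_n :=
  fun i j => (i.+1 == j :> nat) || (j.+1 == i :> nat).

Lemma path_sym n : symmetric (@path_rel n).
Proof. by move=> i j; rewrite /path_rel orbC. Qed.

Lemma path_irr n : irreflexive (@path_rel n).
Proof. by move=> i; rewrite /path_rel orbb gtn_eqF. Qed.

Definition path_graph n : sgraph 'I_n := SGraph (@path_sym n) (@path_irr n).

Local Open Scope ring_scope.

Definition adjmx (R : realType) (T : finType) (G : sgraph T) : 'M[R]_#|T| :=
  \matrix_(i, j) (G (enum_val i) (enum_val j))%:R.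

(* The real eigenvalues, each listed as many times as its multiplicity as a
   root of the characteristic polynomial; [char_poly_spectrum] and
   [size_spectrum] show that this is the whole spectrum of a symmetric A. *)
Definition spectrum (R : realType) n (A : 'M[R]_n) : seq R :=
  flatten [seq nseq (mup x (char_poly A)) x | x <- rootsR (char_poly A)].

(* [powR] satisfies 0 `^ p = 0 for p != 0. *)
Definition schatten_energy (R : realType) (p : R) (T : finType)
    (G : sgraph T) : R :=
  \sum_(x <- spectrum (adjmx R G)) powR `|x| p.

Lemma adjmx_sym (R : realType) (T : finType) (G : sgraph T) :
  (adjmx R G)^T = adjmx R G.
Proof. by apply/matrixP => i j; rewrite !mxE adj_sym. Qed.

Lemma char_poly_sym_splits (R : realType) n (A : 'M[R]_n) :
  A^T = A -> exists s : seq R, char_poly A = \prod_(x <- s) ('X - x%:P).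
Proof.
move=> symA; pose f := real_complex R; pose B := map_mx f A.
have hB : B \is hermsymmx.
  apply/is_hermitianmxP; rewrite expr0 scale1r; apply/matrixP => i j.
  rewrite !mxE -[in LHS]symA mxE; exact: (esym (conjc_real _)).
have /orthomx_spectralP defB := hermitian_normalmx hB.
have real_d := hermitian_spectral_diag_real hB.
set P := spectralmx B in defB; set d := spectral_diag B in defB real_d.
have uP : P \in unitmx by exact: spectral_unit.
have cB : char_poly B = char_poly (diag_mx d).
  rewrite /char_poly /char_poly_mx {1}defB.
  set Q := map_mx polyC P; set Q' := map_mx polyC (invmx P).
  have QQ : Q' *m Q = 1%:M by rewrite -map_mxM mulVmx // map_mx1.
  have -> : 'X%:M - map_mx polyC (invmx P *m diag_mx d *m P)
            = Q' *m ('X%:M - map_mx polyC (diag_mx d)) *m Q.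
    by rewrite !map_mxM mulmxBr mulmxBl scalar_mxC -(mulmxA _ Q' Q) QQ mulmx1.
  by rewrite !det_mulmx mulrAC -det_mulmx QQ det1 mul1r.
exists [seq complex.Re (d 0 i) | i : 'I_n].
apply: (map_poly_inj f); rewrite map_char_poly -/B cB.
rewrite (char_poly_trig (diag_mx_is_trig _)) big_image rmorph_prod /=.
apply: eq_bigr => i _; rewrite mxE eqxx mulr1n rmorphB /= map_polyX map_polyC.
congr (_ - _%:P); apply/esym/RRe_real.
by move/mxOverP: real_d; apply.
Qed.

Lemma count_mem_flatten_nseq (T : eqType) (m : T -> nat) (r : seq T) (x : T) :
  uniq r ->
  count_mem x (flatten [seq nseq (m y) y | y <- r]) = ((x \in r) * m x)%N.
Proof.
elim: r => //= y r IHr /andP[yr ur]; rewrite count_cat IHr // count_nseq inE.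
by rewrite /= [x == y]eq_sym; case: eqVneq => [<-|//]; rewrite (negPf yr) addn0.
Qed.

Lemma char_poly_spectrum (R : realType) n (A : 'M[R]_n) :
  A^T = A -> char_poly A = \prod_(x <- spectrum A) ('X - x%:P).
Proof.
move=> /char_poly_sym_splits[s ps]; rewrite {1}ps; apply: perm_big.
have p0 : char_poly A != 0 by rewrite monic_neq0 ?char_poly_monic.
rewrite perm_sym; apply/allP => x _ /=; apply/eqP.
rewrite count_mem_flatten_nseq ?uniq_roots //.
rewrite -(roots_on_rootsR p0) in_itv /= -(mu_prod_XsubC x s) -ps.
by case: (boolP (root _ _)) => [_|/mupNroot->]; rewrite ?mul1n.
Qed.

Lemma size_spectrum (R : realType) n (A : 'M[R]_n) :
  A^T = A -> size (spectrum A) = n.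
Proof.
move=> /char_poly_spectrum/(congr1 (fun p : {poly R} => size p)).
by rewrite size_char_poly size_prod_XsubC => -[].
Qed.

(* Main.v *)
Require Import Defs.
From mathcomp Require Import all_boot all_order all_algebra.
From mathcomp Require Import complex.
From mathcomp Require Import reals exp sequences topology normedtype.
From mathcomp Require Import ring lra zify.
Set Implicit Arguments.
Unset Strict Implicit.
Unset Printing Implicit Defensive.
Import Order.TTheory GRing.Theory Num.Theory.
Import numFieldNormedType.Exports.
Local Open Scope ring_scope.

(** Let c be an imaginary number and put w = - c ^+ 2 >= 0. For a forest F the
    determinant of 1 + c A_F is the sum of w ^+ k over the matchings of F, k
    being the number of edges of the matching: if v is a leaf hanging from u,
    eliminating v gives

      D(F) = D(F - v) + w D(F - v - u)            ([matching_det_leaf]).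

    Every forest with an edge has a leaf ([acyclic_leaf]), so induction with
    this recursion bounds D from both sides. The path polynomials satisfy the
    recursion with both terms of maximal size, so D(F) is at most the value of
    the path on as many vertices ([matching_det_forest], [matching_det_path]);
    each leaf removed from a tree contributes at least w, so D(T) is at least
    1 + (n - 1) w, which is the value of the star ([matching_det_connected],
    [matching_det_star]).

    On the other hand D = \prod_j (1 + c lambda_j), so for c = i t the square of
    its modulus is \prod_j (1 + t^2 lambda_j^2), and the bounds on D compare
    these products at every t ([prod_spectrum_le]). What remains is a fact about
    nonnegative reals: if \prod (1 + w y_j) <= \prod (1 + w z_j) for all w > 0,
    then \sum y_j^s <= \sum z_j^s for 0 < s < 1 ([power_sum_le]); it is used
    with y_j, z_j the squared eigenvalues and s = p / 2.

    The classical proof of that fact writes y^s, up to a constant, as the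
    integral of w^(-s-1) ln (1 + w y) over w > 0. Here the integral is replaced
    by sums over a geometric progression of ratio q = e^h. The sum of
    q^(-sk) ln (1 + q^k y) over all integers k is multiplied by q^s when y is
    multiplied by q, and it is nondecreasing in y; hence it equals y^s times its
    value at 1 up to a factor between q^(-s) and q^s, and letting q tend to 1
    gives the inequality. Only the sums over - N <= k < N are used, so that no
    convergence is needed beyond that of the terms to 0 at both ends. *)

(** * Power sums are monotone in the products of 1 + w y *)

Definition log_kernel (R : realType) (s y r : R) : R :=
  expR (- (s * r)) * ln (1 + expR r * y).

Definition log_sum (R : realType) (s h y : R) (N : nat) : R :=
  \sum_(0 <= k < N.*2) log_kernel s y ((k%:R - N%:R) * h).

Section PowerSums.
Local Open Scope classical_set_scope.
Variables (R : realType) (s h : R).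
Hypotheses (s_gt0 : 0 < s) (s_lt1 : s < 1) (h_gt0 : 0 < h).

Lemma ln1D_ge0 (x : R) : 0 <= x -> 0 <= ln (1 + x).
Proof. by move=> x0; rewrite ln_ge0 // lerDl. Qed.

Lemma log_kernel_ge0 (y r : R) : 0 <= y -> 0 <= log_kernel s y r.
Proof.
by move=> y0; rewrite mulr_ge0 ?expR_ge0 ?ln1D_ge0 // mulr_ge0 ?expR_ge0.
Qed.

Lemma log_kernel_le (y z r : R) :
  0 <= y -> y <= z -> log_kernel s y r <= log_kernel s z r.
Proof.
move=> y0 yz; rewrite ler_wpM2l ?expR_ge0 // ler_ln ?posrE.
- by rewrite lerD2l ler_wpM2l ?expR_ge0.
- by rewrite ltr_wpDr // mulr_ge0 ?expR_ge0.
- by rewrite ltr_wpDr // mulr_ge0 ?expR_ge0 // (le_trans y0).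
Qed.

Lemma log_sum_le (y z : R) N :
  0 <= y -> y <= z -> log_sum s h y N <= log_sum s h z N.
Proof. by move=> y0 yz; apply: ler_sum => k _; apply: log_kernel_le. Qed.

Lemma log_sum0 N : log_sum s h 0 N = 0.
Proof. by apply: big1 => k _; rewrite /log_kernel mulr0 addr0 ln1 mulr0. Qed.

(** Keeping a single term gives a positive bound independent of N. *)
Lemma log_sum1_ge N : (0 < N)%N -> ln 2 <= log_sum s h 1 N.
Proof.
move=> N0; rewrite /log_sum (bigD1_seq N) ?mem_index_iota ?iota_uniq //=;
  last first.
  by rewrite -addnn -[ltnLHS]addn0 ltn_add2l.
(* The summand k = N has exponent 0. *)
rewrite subrr mul0r {1}/log_kernel mulr0 oppr0 expR0 !mul1r lerDl.
by apply: sumr_ge0 => k _; apply: log_kernel_ge0.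
Qed.

Lemma log_kernel_shift (y r : R) :
  log_kernel s (expR h * y) r = expR (s * h) * log_kernel s y (r + h).
Proof.
rewrite /log_kernel mulrA -expRD mulrA -expRD; congr (expR _ * _); ring.
Qed.

(** Multiplying y by e^h moves the window of summation by one step, so only
    the terms at its two ends remain. *)
Lemma log_sum_shift (y : R) N :
  log_sum s h (expR h * y) N - expR (s * h) * log_sum s h y N =
  expR (s * h) * (log_kernel s y (N%:R * h) - log_kernel s y (- N%:R * h)).
Proof.
pose u k := log_kernel s y ((k%:R - N%:R) * h).
have -> : log_kernel s y (N%:R * h) - log_kernel s y (- N%:R * h)
    = u N.*2 - u 0%N.
  by rewrite /u -addnn natrD addrK sub0r.
rewrite -telescope_sumr // mulr_sumr /log_sum mulr_sumr -sumrB.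
apply: eq_bigr => k _; rewrite log_kernel_shift -mulrBr.
congr (_ * (log_kernel _ _ _ - _)).
rewrite -natr1; ring.
Qed.

(** At - oo the logarithm is at most its argument, and e^(-sr) e^r decays
    because s < 1. *)
Lemma log_kernel_cvgNy (y : R) :
  0 <= y -> log_kernel s y (- N%:R * h) @[N --> \oo] --> (0 : R).
Proof.
move=> y0; apply: (@squeeze_cvgr _ _ _ _ (fun=> 0)
  (geometric y (expR (- ((1 - s) * h))))).
- near=> N; rewrite log_kernel_ge0 //= -expRM_natl.
  have -> : N%:R * - ((1 - s) * h) = - (s * (- N%:R * h)) + - N%:R * h by ring.
  rewrite expRD mulrCA ler_wpM2l ?expR_ge0 // mulrC.
  apply: le_ln1Dx; apply: lt_le_trans (_ : 0 <= _); first by rewrite ltrN10.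
  by rewrite mulr_ge0 ?expR_ge0.
- exact: (@cvg_cst R).
- apply: cvg_geometric; rewrite ger0_norm ?expR_ge0 // expR_lt1 oppr_lt0.
  by rewrite mulr_gt0 ?subr_gt0.
Unshelve. all: by end_near. Qed.

(** At + oo the logarithm grows linearly in r, hence more slowly than e^(sr/2),
    while the weight is e^(-sr). *)
Lemma log_kernel_cvgy (y : R) :
  0 <= y -> log_kernel s y (N%:R * h) @[N --> \oo] --> (0 : R).
Proof.
move=> y0; apply: (@squeeze_cvgr _ _ _ _ (fun=> 0)
  (geometric ((s / 2)^-1 * expR (s / 2 * ln (1 + y))) (expR (- (s / 2 * h))))).
- near=> N; rewrite log_kernel_ge0 //= -expRM_natl.
  have Ny0 : 0 <= N%:R * h by rewrite mulr_ge0 // ltW.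
  have lnle : ln (1 + expR (N%:R * h) * y) <= N%:R * h + ln (1 + y).
    rewrite -{2}[N%:R * h]expRK -lnM ?posrE ?expR_gt0 ?ltr_wpDr //.
    rewrite ler_ln ?posrE ?mulr_gt0 ?expR_gt0 ?ltr_wpDr ?mulr_ge0 ?expR_ge0 //.
    by rewrite mulrDr mulr1 lerD2r -[X in X <= _]expR0 ler_expR.
  set u := N%:R * h + ln (1 + y) in lnle.
  have u_le : u <= (s / 2)^-1 * expR (s / 2 * u).
    rewrite ler_pdivlMl ?divr_gt0 //.
    by apply: le_trans (expR_ge1Dx _); rewrite lerDr.
  apply: le_trans (ler_wpM2l (expR_ge0 _) (le_trans lnle u_le)) _.
  rewrite mulrCA -[leRHS]mulrA -!expRD; apply: ler_wpM2l.
    by rewrite invr_ge0 divr_ge0 // ltW.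
  by rewrite ler_expR /u le_eqVlt; apply/orP; left; apply/eqP; field.
- exact: (@cvg_cst R).
- apply: cvg_geometric; rewrite ger0_norm ?expR_ge0 // expR_lt1 oppr_lt0.
  by rewrite mulr_gt0 ?divr_gt0.
Unshelve. all: by end_near. Qed.

Lemma cvg0_linear (u v w : nat -> R) (a b : R) :
  u @ \oo --> (0 : R) -> v @ \oo --> (0 : R) ->
  (forall N, w N = a * u N + b * v N) -> w @ \oo --> (0 : R).
Proof.
move=> u0 v0 wE; have -> : w = (fun N => a * u N) \+ (fun N => b * v N).
  by apply/boolp.funext => N; rewrite wE.
rewrite (_ : 0 = a * 0 + b * 0 :> R); last by rewrite !mulr0 addr0.
by apply: cvgD; apply: cvgMl_tmp.
Qed.

(** The failure of the truncated sum to be exactly homogeneous of degree s at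
    the lattice point e^(z h). *)
Definition log_sum_defect (z : int) (N : nat) : R :=
  log_sum s h (expR (z%:~R * h)) N - expR (s * (z%:~R * h)) * log_sum s h 1 N.

Lemma log_sum_defectS (z : int) N :
  log_sum_defect (z + 1) N = expR (s * h) * log_sum_defect z N +
  (log_sum s h (expR h * expR (z%:~R * h)) N
    - expR (s * h) * log_sum s h (expR (z%:~R * h)) N).
Proof.
rewrite /log_sum_defect rmorphD /= mulrDl mul1r [_ + h]addrC mulrDr !expRD.
by ring.
Qed.

Lemma log_sum_defect_cvg (z : int) : log_sum_defect z @ \oo --> (0 : R).
Proof.
have shift0 (y : R) : 0 <= y ->
    (fun N => log_sum s h (expR h * y) N - expR (s * h) * log_sum s h y N)
      @ \oo --> (0 : R).
  move=> y0; apply: (cvg0_linear (a := expR (s * h)) (b := - expR (s * h))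
    (log_kernel_cvgy y0) (log_kernel_cvgNy y0)) => N.
  by rewrite log_sum_shift; ring.
elim/int_ind: z => [|m IHm|m IHm].
- have sh0 := shift0 0 (lexx _).
  apply: (cvg0_linear (a := 0) (b := 0) sh0 sh0) => N.
  by rewrite /log_sum_defect mul0r mulr0 expR0 !mul0r mul1r subrr addr0.
- apply: (cvg0_linear (b := 1) IHm (shift0 _ (expR_ge0 (m%:~R * h)))) => N.
  by rewrite intS addrC log_sum_defectS mul1r.
- pose z : int := - m.+1%:Z; have zS : z + 1 = - m%:Z by rewrite /z; lia.
  rewrite -zS in IHm.
  apply: (cvg0_linear (a := expR (- (s * h))) (b := - expR (- (s * h)))
    IHm (shift0 _ (expR_ge0 (z%:~R * h)))) => N.
  rewrite mulNr -mulrBr log_sum_defectS addrK mulrA -expRD addNr expR0.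
  by rewrite mul1r.
Qed.

(** A positive y lies between two consecutive lattice points e^(z h) and
    e^((z + 1) h), where the sum is homogeneous up to a defect tending to 0; by
    monotonicity, rounding y costs a factor at most e^(s h). *)
Lemma log_sum_approx (y : R) : 0 <= y -> exists2 d : nat -> R,
  d @ \oo --> (0 : R) &
  forall N, expR (- (s * h)) * y `^ s * log_sum s h 1 N - d N <= log_sum s h y N
    <= expR (s * h) * y `^ s * log_sum s h 1 N + d N.
Proof.
rewrite le_eqVlt => /predU1P[<-|y0].
  exists (fun=> 0); first exact: cvg_cst.
  by move=> N; rewrite log_sum0 powR0 ?gt_eqF // !mulr0 !mul0r subr0 addr0 lexx.
pose z := Num.floor (ln y / h).
have /andP[zle ltz] := floor_itv (ln y / h).
have {}zle : expR (z%:~R * h) <= y.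
  by rewrite -[leRHS]lnK ?posrE // ler_expR -ler_pdivlMr.
have {}ltz : y <= expR ((z + 1)%:~R * h).
  by rewrite -[leLHS]lnK ?posrE // ler_expR -ler_pdivrMr // ltW.
have powE x : expR (s * x) = expR x `^ s.
  by rewrite /powR gt_eqF ?expR_gt0 // expRK.
have zS : expR (s * ((z + 1)%:~R * h)) = expR (s * h) * expR (s * (z%:~R * h)).
  by rewrite -expRD; congr expR; rewrite rmorphD /=; ring.
have zle_s : expR (s * (z%:~R * h)) <= y `^ s.
  by rewrite powE ge0_ler_powR ?nnegrE ?expR_ge0 // ltW.
have ltz_s : y `^ s <= expR (s * ((z + 1)%:~R * h)).
  by rewrite powE ge0_ler_powR ?nnegrE ?expR_ge0 // ltW.
exists (fun N => `|log_sum_defect z N| + `|log_sum_defect (z + 1) N|).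
  have normcvg w : (fun N => `|log_sum_defect w N|) @ \oo --> (0 : R).
    by have := cvg_norm (log_sum_defect_cvg w); rewrite normr0; apply.
  apply: (cvg0_linear (a := 1) (b := 1) (normcvg z) (normcvg (z + 1))) => N.
  by rewrite !mul1r.
move=> N; have L1 : 0 <= log_sum s h 1 N.
  by apply: sumr_ge0 => k _; apply: log_kernel_ge0.
apply/andP; split.
  apply: le_trans (log_sum_le N (expR_ge0 _) zle).
  rewrite lerBlDr -lerBlDl.
  have := ler_norm (- log_sum_defect z N); rewrite normrN opprB => /le_trans.
  have d1 := normr_ge0 (log_sum_defect (z + 1) N).
  move=> H; apply: (@le_trans _ _ (expR (s * (z%:~R * h)) * log_sum s h 1 N
     - log_sum s h (expR (z%:~R * h)) N)); last by apply: H; rewrite lerDl.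
  rewrite lerD2r ler_wpM2r // -ler_pdivlMl ?expR_gt0 // expRN invrK -zS //.
apply: le_trans (log_sum_le N (ltW y0) ltz) _.
have := ler_norm (log_sum_defect (z + 1) N).
rewrite lerBlDr => /le_trans; apply.
rewrite addrC lerD //; last by rewrite lerDr.
by rewrite ler_wpM2r // zS ler_wpM2l // expR_ge0.
Qed.

Lemma log_sum_approx_seq (ys : seq R) : all (>= 0) ys -> exists2 d : nat -> R,
  d @ \oo --> (0 : R) &
  forall N,
  expR (- (s * h)) * (\sum_(y <- ys) y `^ s) * log_sum s h 1 N - d N
    <= \sum_(y <- ys) log_sum s h y N
    <= expR (s * h) * (\sum_(y <- ys) y `^ s) * log_sum s h 1 N + d N.
Proof.
elim: ys => [_|y ys IHys /= /andP[/log_sum_approx[d d0 dP] /IHys[d' d'0 dP']]].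
  exists (fun=> 0); first exact: cvg_cst.
  by move=> N; rewrite !big_nil !mulr0 !mul0r subr0 addr0 lexx.
exists (d \+ d').
  by apply: (cvg0_linear (a := 1) (b := 1) d0 d'0) => N; rewrite !mul1r.
move=> N; have /andP[? ?] := dP N; have /andP[? ?] := dP' N.
by rewrite !big_cons /=; lra.
Qed.

(** For each k the logarithms add up to the logarithm of a product, with
    w = e^r for r the k-th exponent. *)
Lemma log_sum_prod_le (ys zs : seq R) N :
  all (>= 0) ys -> all (>= 0) zs ->
  (forall w, 0 < w ->
     \prod_(y <- ys) (1 + w * y) <= \prod_(z <- zs) (1 + w * z)) ->
  \sum_(y <- ys) log_sum s h y N <= \sum_(z <- zs) log_sum s h z N.
Proof.
move=> ys0 zs0 prod_le; rewrite /log_sum exchange_big [leRHS]exchange_big /=.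
apply: ler_sum => k _; rewrite /log_kernel -!mulr_sumr ler_wpM2l ?expR_ge0 //.
set w := expR _; have w0 : 0 < w := expR_gt0 _.
have expE xs : all (>= 0) xs ->
    expR (\sum_(x <- xs) ln (1 + w * x)) = \prod_(x <- xs) (1 + w * x).
  move=> /allP xs0; rewrite expR_sum !big_seq; apply: eq_bigr => x /xs0 x0.
  by rewrite lnK // posrE ltr_wpDr // mulr_ge0 // ltW.
by rewrite -ler_expR !expE ?prod_le.
Qed.

(** Comparing the two approximations, the gap between both sides times
    [log_sum s h 1 N] is at most a sequence tending to 0, while
    [log_sum s h 1 N >= ln 2]. *)
Lemma power_sum_le_approx (ys zs : seq R) :
  all (>= 0) ys -> all (>= 0) zs ->
  (forall w, 0 < w ->
     \prod_(y <- ys) (1 + w * y) <= \prod_(z <- zs) (1 + w * z)) ->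
  expR (- (s * h)) * \sum_(y <- ys) y `^ s
    <= expR (s * h) * \sum_(z <- zs) z `^ s.
Proof.
move=> ys0 zs0 prod_le.
have [d d0 dP] := log_sum_approx_seq ys0.
have [d' d'0 dP'] := log_sum_approx_seq zs0.
rewrite leNgt; apply/negP; rewrite -subr_gt0; set g := _ - _ => g0.
have sum0 : (fun N => d N + d' N) @ \oo --> (0 : R).
  by apply: (cvg0_linear (a := 1) (b := 1) d0 d'0) => N; rewrite !mul1r.
have ln2 : 0 < ln 2 :> R by rewrite ln_gt0 // ltr1n.
have [N1 _ dlt] := cvgr0_norm_lt _ sum0 _ (mulr_gt0 g0 ln2).
have {}dlt := dlt N1.+1 (leqnSn _).
have /andP[lo _] := dP N1.+1; have /andP[_ up] := dP' N1.+1.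
have mid := log_sum_prod_le N1.+1 ys0 zs0 prod_le.
have gL := ler_wpM2l (ltW g0) (log_sum1_ge (ltn0Sn N1)).
rewrite [leRHS]mulrBl in gL.
have dd := ler_norm (d N1.+1 + d' N1.+1).
move: (g * _) gL dlt => gl gL dlt.
lra.
Qed.

End PowerSums.

Lemma power_sum_le (R : realType) (s : R) (ys zs : seq R) :
  0 < s -> s < 1 -> all (>= 0) ys -> all (>= 0) zs ->
  (forall w, 0 < w ->
     \prod_(y <- ys) (1 + w * y) <= \prod_(z <- zs) (1 + w * z)) ->
  \sum_(y <- ys) y `^ s <= \sum_(z <- zs) z `^ s.
Proof.
move=> s0 s1 ys0 zs0 prod_le.
set Y := \sum_(y <- _) _; set Z := \sum_(z <- _) _.
rewrite leNgt; apply/negP => ZY.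
have Z0 : 0 <= Z by apply: sumr_ge0 => z _; apply: powR_ge0.
(* The estimate for a single ratio e^h, which has to be made small. *)
have approx h : 0 < h -> Y <= expR (2 * (s * h)) * Z.
  move=> h0; have := power_sum_le_approx s0 s1 h0 ys0 zs0 prod_le.
  rewrite expRN ler_pdivrMl ?expR_gt0 // => /le_trans; apply.
  by rewrite [leLHS]mulrA -expRD mulr_natl mulr2n.
move: Z0; rewrite le_eqVlt => /predU1P[ZE|Z0].
  by have := approx 1 ltr01; rewrite -ZE mulr0 leNgt ZE ZY.
(* This h makes the loss e^(2sh) equal to the square root of Y / Z. *)
have YZ0 : 0 < ln (Y / Z) by rewrite ln_gt0 // ltr_pdivlMr // mul1r.
have s4 : 0 < 4 * s by rewrite mulr_gt0.
have := approx _ (divr_gt0 YZ0 s4).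
rewrite -ler_pdivrMr // -{1}[Y / Z]lnK ?posrE ?divr_gt0 // ?(lt_trans Z0) //.
have -> : 2 * (s * (ln (Y / Z) / (4 * s))) = ln (Y / Z) / 2.
  by field; rewrite gt_eqF.
by rewrite ler_expR; lra.
Qed.

(** * The leaf recursion for determinants *)

Lemma det_row_linear (R : comNzRingType) n (A B C : 'M[R]_n) i0 b c :
    (forall j, A i0 j = b * B i0 j + c * C i0 j) ->
    (forall i j, i != i0 -> B i j = A i j) ->
    (forall i j, i != i0 -> C i j = A i j) ->
  \det A = b * \det B + c * \det C.
Proof.
move=> Ai0 BA CA; apply: (@determinant_multilinear _ _ A B C i0).
- by apply/rowP => j; rewrite !mxE.
- by apply/matrixP => i j; rewrite !mxE BA ?neq_lift // eq_sym neq_lift.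
- by apply/matrixP => i j; rewrite !mxE CA // eq_sym neq_lift.
Qed.

Lemma det_row_op (R : comNzRingType) n (A B : 'M[R]_n) i0 i1 c :
    i1 != i0 ->
    (forall j, B i0 j = A i0 j + c * A i1 j) ->
    (forall i j, i != i0 -> B i j = A i j) ->
  \det B = \det A.
Proof.
move=> i10 Bi0 BA.
pose C := \matrix_(i, j) A (if i == i0 then i1 else i) j.
rewrite (@det_row_linear _ _ B A C i0 1 c).
- rewrite (@determinant_alternate _ _ C i0 i1) 1?eq_sym //; first by ring.
  by move=> j; rewrite !mxE eqxx (negPf i10).
- by move=> j; rewrite !mxE eqxx mul1r Bi0.
- by move=> i j ii0; rewrite BA.
- by move=> i j ii0; rewrite !mxE (negPf ii0) BA.
Qed.

Lemma det_col_op (R : comNzRingType) n (A B : 'M[R]_n) j0 j1 c :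
    j1 != j0 ->
    (forall i, B i j0 = A i j0 + c * A i j1) ->
    (forall i j, j != j0 -> B i j = A i j) ->
  \det B = \det A.
Proof.
move=> j10 Bj0 BA; rewrite -[LHS]det_tr -[RHS]det_tr.
apply: (@det_row_op _ _ _ _ j0 j1 c) => // [j|i j ij0].
  by rewrite !mxE Bj0.
by rewrite !mxE BA.
Qed.

(** Expanding along row k shows that column k is irrelevant. *)
Lemma det_unit_row (R : comNzRingType) n (A B : 'M[R]_n) k :
    (forall j, A k j = (k == j)%:R) -> (forall j, B k j = (k == j)%:R) ->
    (forall i j, i != k -> j != k -> A i j = B i j) ->
  \det A = \det B.
Proof.
have detE (C : 'M[R]_n) :
    (forall j, C k j = (k == j)%:R) -> \det C = cofactor C k k.
  move=> Ck; rewrite (expand_det_row C k) (bigD1 k) //= Ck eqxx mul1r.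
  rewrite big1 ?addr0 //.
  by move=> j jk; rewrite Ck eq_sym (negPf jk) mul0r.
move=> Ak Bk AB; rewrite !detE //; congr (_ * \det _).
by apply/matrixP => i j; rewrite !mxE AB // eq_sym neq_lift.
Qed.

Definition is_leaf (T : finType) (e : rel T) (S : {set T}) (v u : T) : Prop :=
  [/\ v \in S, u \in S & {in S, forall w, e v w = (w == u)}].

Lemma leaf_neq (T : finType) (e : rel T) (S : {set T}) v u :
  irreflexive e -> is_leaf e S v u -> v != u.
Proof.
move=> e_irr [vS uS vE]; apply/eqP => vEu.
by have := vE u uS; rewrite vEu e_irr eqxx.
Qed.

(** The matrix 1 + c A for the graph induced on S. The vertices outside S are
    kept as isolated ones, which contribute a factor 1 to the determinant, so
    that deleting vertices does not change the size of the matrix. *)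
Definition matching_mx (R : comNzRingType) (c : R) n (e : rel 'I_n)
    (S : {set 'I_n}) : 'M[R]_n :=
  \matrix_(i, j) ((i == j)%:R + c * [&& i \in S, j \in S & e i j]%:R).

(** The entry 1 at (v, v) clears the two entries c at (u, v) and (v, u). This
    isolates v and subtracts c ^+ 2 from the entry (u, u); by linearity in row u
    the determinant then splits into the one without v and - c ^+ 2 times the
    one where row u is a unit vector, that is, without v and u. *)
Lemma det_matching_mx_leaf (R : comNzRingType) (c : R) n (e : rel 'I_n)
    (S : {set 'I_n}) v u :
  symmetric e -> irreflexive e -> is_leaf e S v u ->
  \det (matching_mx c e S) =
    \det (matching_mx c e (S :\ v))
      + (- c ^+ 2) * \det (matching_mx c e (S :\ v :\ u)).
Proof.
move=> e_sym e_irr vu_leaf; have vNu := leaf_neq e_irr vu_leaf.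
have uNv : u != v by rewrite eq_sym.
case: vu_leaf => vS uS vE.
have Ev w : [&& v \in S, w \in S & e v w] = (w == u).
  rewrite vS; case wS: (w \in S); rewrite /= ?vE //.
  by case: eqP wS => // ->; rewrite uS.
have Ev' w : [&& w \in S, v \in S & e w v] = (w == u).
  by rewrite -Ev e_sym vS; case: (w \in S).
(* M1 and M2 come from M by the row and the column operation on u; M3 has the
   unit vector as its row u. *)
pose M := matching_mx c e S.
pose M1 := \matrix_(i, j) (M i j - (i == u)%:R * c * M v j).
pose M2 := \matrix_(i, j) (M1 i j - (j == u)%:R * c * M1 i v).
have M2E i j : M2 i j =
   matching_mx c e (S :\ v) i j - c ^+ 2 * ((i == u) && (j == u))%:R.
  rewrite !mxE !Ev !Ev' !in_setD1 eqxx [v == u](negPf vNu) [_ == v]eq_sym.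
  have [->|iv] := eqVneq i v.
    by rewrite !Ev (negPf vNu) /=; case: (v == j); case: (j == u);
      rewrite ?(mulr0n, mulr1n); ring.
  rewrite /= [v == j]eq_sym.
  have [->|jv] := eqVneq j v.
    by rewrite !Ev' (negPf iv) (negPf vNu) /= andbF; case: (i == u);
      rewrite ?(mulr0n, mulr1n); ring.
  by case: (i == u); case: (j == u); case: (i == j); case: (_ && _);
    rewrite ?(mulr0n, mulr1n); ring.
pose M3 := \matrix_(i, j) (if i == u then (i == j)%:R else M2 i j).
have -> : \det M = \det M2.
  transitivity (\det M1).
    symmetry; apply: (@det_row_op _ _ _ _ u v (- c)) => // [j|i j iu];
      rewrite [LHS]mxE.
      by rewrite eqxx mul1r mulNr.
    by rewrite (negPf iu) !mul0r subr0.
  symmetry; apply: (@det_col_op _ _ _ _ u v (- c)) => // [i|i j ju];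
    rewrite [LHS]mxE.
    by rewrite eqxx mul1r mulNr.
  by rewrite (negPf ju) !mul0r subr0.
rewrite (@det_row_linear _ _ M2 (matching_mx c e (S :\ v)) M3 u 1 (- c ^+ 2)).
- rewrite mul1r; congr (_ + _ * _).
  apply: (@det_unit_row _ _ _ _ u) => [j|j|i j iu ju].
  + by rewrite mxE eqxx.
  + by rewrite !mxE !in_setD1 eqxx /= mulr0 addr0.
  + by rewrite mxE (negPf iu) M2E (negPf iu) mulr0 subr0 !mxE !in_setD1 iu ju.
- by move=> j; rewrite M2E [M3 _ _]mxE eqxx [u == j]eq_sym mul1r mulNr.
- by move=> i j iu; rewrite M2E (negPf iu) mulr0 subr0.
- by move=> i j iu; rewrite mxE (negPf iu).
Qed.


(** For a forest, the matching generating polynomial of the graph induced on S,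
    evaluated at - c ^+ 2. *)
Definition matching_det (R : comNzRingType) (c : R) (T : finType) (G : sgraph T)
    (S : {set T}) : R :=
  \det (matching_mx c (fun i j => G (enum_val i) (enum_val j))
          (@enum_val T T @^-1: S)).

Lemma matching_det_edgeless (R : comNzRingType) (c : R) (T : finType)
    (G : sgraph T) (S : {set T}) :
  {in S &, forall x y, ~~ G x y} -> matching_det c G S = 1.
Proof.
move=> S0; rewrite /matching_det -[RHS](det1 R #|T|); congr (\det _).
apply/matrixP => i j; rewrite !mxE !inE; case: and3P => [[iS jS]|_].
  by rewrite (negPf (S0 _ _ iS jS)).
by rewrite mulr0 addr0.
Qed.

Lemma matching_det_leaf (R : comNzRingType) (c : R) (T : finType)
    (G : sgraph T) (S : {set T}) v u :
  is_leaf G S v u ->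
  matching_det c G S =
    matching_det c G (S :\ v) + (- c ^+ 2) * matching_det c G (S :\ v :\ u).
Proof.
move=> [vS uS vE]; have rankD1 A x :
    @enum_val T T @^-1: (A :\ x) = (@enum_val T T @^-1: A) :\ enum_rank x.
  by apply/setP => i; rewrite !inE -(can_eq enum_rankK) enum_valK.
rewrite /matching_det !rankD1; apply: det_matching_mx_leaf => [i j|i|].
- by rewrite adj_sym.
- by rewrite adj_irr.
- split=> [||i]; rewrite ?inE ?enum_rankK // => iS.
  by rewrite vE // -(can_eq enum_rankK) enum_valK.
Qed.

(** * Matching determinants of forests *)

(** An end of a longest simple path in S is a leaf: a second neighbour would
    either extend the path or close a cycle. *)
Lemma acyclic_leaf (T : finType) (G : sgraph T) (S : {set T}) x y :
  acyclic_graph G -> x \in S -> y \in S -> G x y ->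
  exists v u, is_leaf G S v u.
Proof.
move=> acycG.
suff long_path k a b q :
    (#|S| <= size q + k)%N -> path G a (b :: q) -> uniq [:: a, b & q] ->
    all [in S] [:: a, b & q] -> exists v u, is_leaf G S v u.
  move=> xS yS xy; apply: (long_path #|S| x y [::]); rewrite //= ?xy ?xS ?yS //.
  by rewrite inE andbT; apply: contraTneq xy => ->; rewrite adj_irr.
(* The induction is on the number k of vertices of S that the path may still
   gain. *)
elim: k a b q => [|k IHk] a b q.
  rewrite addn0 => le_Sq _ uq /allP qS; have := card_uniqP uq => sz_q.
  have /subset_leq_card : [:: a, b & q] \subset S by apply/subsetP.
  by rewrite sz_q /= => /leq_trans /(_ le_Sq); rewrite ltnNge leqnSn.
move=> le_Sq pq uq allS; have [aS bS] : a \in S /\ b \in S by case/and3P: allS.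
have ab : G a b by case/andP: pq.
case: (pickP (fun z => [&& z \in S, G a z & z != b])) =>
  [z /and3P[zS az zb]|noz].
  have zNa : z != a by apply: contraTneq az => ->; rewrite adj_irr.
  have [zq|zNq] := boolP (z \in q); last first.
    apply: (IHk z a (b :: q)).
    - by rewrite /= addSnnS.
    - by rewrite /= adj_sym az.
    - by rewrite cons_uniq uq !inE negb_or zNa negb_or zb zNq.
    - by rewrite /= zS.
  case/splitPr: zq pq uq => q1 q2 pq uq.
  suff /acycG : ucycle G [:: a, b & rcons q1 z] by rewrite /= size_rcons.
  apply/andP; split.
    rewrite /= rcons_path last_rcons [G z a]adj_sym az andbT.
    by move: pq; rewrite -cat_rcons /= cat_path => /and3P[-> ->].
  by move: uq; rewrite -cat_rcons -!cat_cons cat_uniq => /andP[].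
exists a, b; split=> // z zS; apply/idP/eqP => [az|->//].
by apply/eqP; have /= := noz z; rewrite zS az /= => /negbFE.
Qed.

(** The matching generating polynomial of the path on n vertices. *)
Fixpoint path_poly (R : pzRingType) (w : R) n : R :=
  if n is m.+1 then
    if m is k.+1 then path_poly w m + w * path_poly w k else 1
  else 1.

Lemma path_polySS (R : pzRingType) (w : R) n :
  path_poly w n.+2 = path_poly w n.+1 + w * path_poly w n.
Proof. by []. Qed.

Lemma path_poly_ge1 (R : numDomainType) (w : R) n :
  0 <= w -> 1 <= path_poly w n.
Proof.
move=> w0; elim/ltn_ind: n => -[|[|n]] IHn //.
apply: le_trans (IHn n.+1 _) _ => //; rewrite lerDl mulr_ge0 //.
by rewrite (le_trans ler01) ?IHn.
Qed.

Lemma card_leaf_del (T : finType) (e : rel T) (S : {set T}) v u :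
  irreflexive e -> is_leaf e S v u ->
  #|S| = #|S :\ v :\ u|.+2 /\ #|S :\ v| = #|S :\ v :\ u|.+1.
Proof.
move=> e_irr vu; have vNu := leaf_neq e_irr vu; case: vu => vS uS _.
by rewrite (cardsD1 v S) (cardsD1 u (S :\ v)) vS in_setD1 eq_sym vNu uS.
Qed.

(** Deleting a leaf and its neighbour leaves forests with one and two vertices
    fewer, and the leaf recursion has nonnegative coefficients: it propagates
    both bounds, the upper one being the recursion of the path. *)
Lemma matching_det_forest (R : numDomainType) (c : R) (T : finType)
    (G : sgraph T) (S : {set T}) :
  acyclic_graph G -> c ^+ 2 <= 0 ->
  1 <= matching_det c G S <= path_poly (- c ^+ 2) #|S|.
Proof.
move=> acycG c2; have w0 : 0 <= - c ^+ 2 by rewrite oppr_ge0.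
have [k] := ubnP #|S|; elim: k S => // k IHk S /ltnSE le_Sk.
have [S0|[x [y [xS yS xy]]]] :
    {in S &, forall x y, ~~ G x y} \/ exists x y, [/\ x \in S, y \in S & G x y].
- have [/existsP[x /existsP[y /and3P[xS yS xy]]]|noxy] :=
    boolP [exists x, exists y, [&& x \in S, y \in S & G x y]].
    by right; exists x, y.
  left=> x y xS yS; apply: contraNN noxy => xy.
  by apply/existsP; exists x; apply/existsP; exists y; rewrite xS yS.
- by rewrite matching_det_edgeless // lexx path_poly_ge1.
have [v [u vu]] := acyclic_leaf acycG xS yS xy.
have [cardS cardSv] := card_leaf_del (@adj_irr _ G) vu.
have /andP[lb1 ub1] : 1 <= matching_det c G (S :\ v)
    <= path_poly (- c ^+ 2) #|S :\ v|.
  by apply: IHk; rewrite cardSv -cardS.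
have /andP[lb2 ub2] : 1 <= matching_det c G (S :\ v :\ u)
    <= path_poly (- c ^+ 2) #|S :\ v :\ u|.
  by apply: IHk; apply: leq_trans le_Sk; rewrite cardS ltnW.
rewrite (matching_det_leaf _ vu) cardS path_polySS -cardSv.
rewrite lerD ?ler_wpM2l // andbT (le_trans lb1) // lerDl mulr_ge0 //.
exact: le_trans lb2.
Qed.

(** Connectedness of the induced graph, stated with cuts: in this form it
    passes to the complement of a leaf without rerouting any path. *)
Definition connected_in (T : finType) (e : rel T) (S : {set T}) : Prop :=
  forall X : {set T}, X \proper S -> X != set0 ->
  exists x y, [/\ x \in X, y \in S :\: X & e x y].

(** A cut X of the graph without v becomes a cut of the whole graph once v is
    put on the side of its only neighbour u; an edge across it then avoids v. *)
Lemma connected_in_leaf_del (T : finType) (e : rel T) (S : {set T}) v u :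
  symmetric e -> irreflexive e -> is_leaf e S v u ->
  connected_in e S -> connected_in e (S :\ v).
Proof.
move=> e_sym e_irr vu connS X XS X0; have vNu := leaf_neq e_irr vu.
case: vu => vS uS vE.
have vX : v \notin X.
  by apply/negP => /(subsetP (proper_sub XS)); rewrite !inE eqxx.
have [uX|uX] := boolP (u \in X).
  have [||x [y [xX]]] := connS (v |: X).
  - rewrite properE subUset sub1set vS.
    rewrite (subset_trans (proper_sub XS)) ?subD1set //=.
    have /properP[_ [z]] := XS; rewrite !inE => /andP[zv zS] zX.
    by apply/subsetPn; exists z; rewrite // !inE negb_or zv.
  - by apply/set0Pn; exists v; rewrite setU11.
  rewrite !inE negb_or -andbA => /and3P[yv yX yS] xy; exists x, y.
  rewrite !inE yv yX yS; split=> //; case/setU1P: xX xy => // ->.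
  by rewrite vE // => /eqP yu; rewrite yu uX in yX.
have [||x [y [xX]]] := connS X => //.
  by apply: (proper_sub_trans XS); apply: subD1set.
rewrite !inE => /andP[yX yS] xy; exists x, y.
rewrite !inE yX yS andbT; split=> //.
apply: contraNneq uX => yv; move: xy; rewrite yv e_sym vE; first by move/eqP <-.
by have := subsetP (proper_sub XS) x xX; rewrite !inE => /andP[].
Qed.

(** The right-hand side dominates the terms of degree at most 1 in - c ^+ 2: a
    connected graph on S has at least #|S| - 1 edges. The edges are counted
    through the leaves, each leaf recursion adding at least - c ^+ 2. *)
Lemma matching_det_connected (R : numDomainType) (c : R) (T : finType)
    (G : sgraph T) (S : {set T}) :
  acyclic_graph G -> c ^+ 2 <= 0 -> connected_in G S -> S != set0 ->
  1 + (- c ^+ 2) *+ #|S|.-1 <= matching_det c G S.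
Proof.
move=> acycG c2; have w0 : 0 <= - c ^+ 2 by rewrite oppr_ge0.
have [k] := ubnP #|S|.
elim: k S => // k IHk S /ltnSE le_Sk connS /set0Pn[x0 x0S].
have [Sle1|Sgt1] := leqP #|S| 1.
  move: Sle1; rewrite -subn_eq0 subn1 => /eqP ->; rewrite mulr0n addr0.
  by case/andP: (matching_det_forest S acycG c2).
have [||x [y [/set1P-> /setDP[yS _] xy]]] := connS [set x0].
- by rewrite properEcard sub1set x0S cards1.
- by apply/set0Pn; exists x0; rewrite set11.
have [v [u vu]] := acyclic_leaf acycG x0S yS xy.
have [cardS cardSv] := card_leaf_del (@adj_irr _ G) vu.
rewrite (matching_det_leaf _ vu) cardS /= mulrSr addrA lerD //.
  have -> : #|S :\ v :\ u| = #|S :\ v|.-1 by rewrite cardSv.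
  apply: IHk.
  - by rewrite cardSv -cardS.
  - exact: (connected_in_leaf_del (@adj_sym _ G) (@adj_irr _ G) vu).
  - by rewrite -card_gt0 cardSv.
rewrite -{1}[- c ^+ 2]mulr1 ler_wpM2l //.
by case/andP: (matching_det_forest (S :\ v :\ u) acycG c2).
Qed.

Lemma connected_in_setT (T : finType) (G : sgraph T) :
  connected_graph G -> connected_in G [set: T].
Proof.
move=> connG X /properP[_ [z _ zX]] /set0Pn[x xX].
have /connectP[q] := connG x z.
elim: q x xX => [|y q IHq] x xX /= => [_ zx|/andP[xy yq] zl].
  by rewrite zx xX in zX.
have [yX|yX] := boolP (y \in X); first exact: (IHq y).
by exists x, y; rewrite !inE yX.
Qed.

(** * The star and the path *)

(** Removing a leaf of a star together with its centre leaves no edge. *)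
Lemma matching_det_star (R : comNzRingType) (c : R) n :
  (0 < n)%N ->
  matching_det c (star_graph n) [set: 'I_n] = 1 + (- c ^+ 2) *+ n.-1.
Proof.
case: n => // n _.
(* All sets containing the centre, so that leaves can be deleted. *)
suff star_in (S : {set 'I_n.+1}) : ord0 \in S ->
    matching_det c (star_graph n.+1) S = 1 + (- c ^+ 2) *+ #|S|.-1.
  by rewrite star_in ?inE // cardsT card_ord.
have [k] := ubnP #|S|; elim: k S => // k IHk S /ltnSE le_Sk S0.
have [S1|/set0Pn[v /setD1P[v0 vS]]] := eqVneq (S :\ ord0) set0.
  rewrite (cardsD1 ord0) S0 S1 cards0 mulr0n addr0.
  apply: matching_det_edgeless.
  suff SE x : x \in S -> x = ord0 by move=> x y /SE-> /SE->; rewrite adj_irr.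
  move=> xS; apply/eqP/negPn/negP => x0.
  by have := in_set0 x; rewrite -S1 !inE x0 xS.
have vu : is_leaf (star_graph n.+1) S v ord0.
  split=> // w _; rewrite /= /star_rel.
  rewrite -[v == 0 :> nat]/(v == ord0) -[w == 0 :> nat]/(w == ord0).
  rewrite (negPf v0) /=.
  by case: (w =P ord0) => [->|_]; rewrite ?v0 ?andbF.
have [cardS cardSv] := card_leaf_del (@star_irr _) vu.
rewrite (matching_det_leaf _ vu) IHk ?inE; last 2 first.
- by rewrite cardSv -cardS.
- by rewrite eq_sym v0.
rewrite matching_det_edgeless ?mulr1 => [|x y].
  by rewrite cardS cardSv /= mulrSr addrA.
rewrite !inE /= /star_rel => /and3P[/negPf x0 _ _] /and3P[/negPf y0 _ _].
by rewrite -!val_eqE in x0 y0; rewrite x0 y0 andbF.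
Qed.

(** The last vertex of a path is a leaf, so initial segments of the path follow
    the recursion of [path_poly]. *)
Lemma matching_det_path (R : comNzRingType) (c : R) n :
  matching_det c (path_graph n) [set: 'I_n] = path_poly (- c ^+ 2) n.
Proof.
suff path_in k : (k <= n)%N ->
    matching_det c (path_graph n) [set i : 'I_n | (i < k)%N]
      = path_poly (- c ^+ 2) k.
  rewrite -path_in //; congr matching_det.
  by apply/setP => i; rewrite !inE ltn_ord.
elim/ltn_ind: k => -[|[|k]] IHk kn.
- by rewrite matching_det_edgeless // => x y; rewrite inE.
- rewrite matching_det_edgeless // => x y.
  rewrite !inE !ltnS !leqn0 => /eqP x0 /eqP y0.
  by rewrite /= /path_rel x0 y0.
have vu : is_leaf (path_graph n) [set i : 'I_n | (i < k.+2)%N]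
    (Ordinal kn) (Ordinal (ltnW kn)).
  split=> [||w]; rewrite !inE //= /path_rel /= => wk.
  by rewrite gtn_eqF.
rewrite (matching_det_leaf _ vu).
rewrite path_polySS -IHk ?(ltnW kn) // -(IHk k) ?(ltnW (ltnW kn)) //.
congr (_ + _ * _); congr matching_det;
  apply/setP => i; rewrite !inE -!val_eqE /=; lia.
Qed.

(** * From the spectrum to the matching determinant *)

(** The characteristic polynomial at - c^-1, rescaled by - c. *)
Lemma det_add1_spectrum (R : realType) (K : fieldType) (f : {rmorphism R -> K})
    n (A : 'M[R]_n) (c : K) :
  A^T = A -> c != 0 ->
  \det (1%:M + c *: map_mx f A) = \prod_(x <- spectrum A) (1 + c * f x).
Proof.
move=> symA c0; pose z := - c^-1.
have cz : - c * z = 1 by rewrite mulrNN divff.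
have -> : 1%:M + c *: map_mx f A = (- c) *: (z%:M - map_mx f A).
  by rewrite scalerBr scale_scalar_mx cz scaleNr opprK.
have -> : \prod_(x <- spectrum A) (1 + c * f x)
    = (- c) ^+ n * \prod_(x <- spectrum A) (z - f x).
  have -> : (- c) ^+ n = \prod_(x <- spectrum A) (- c).
    by rewrite big_const_seq count_predT size_spectrum // iter_mulr_1.
  rewrite -big_split /=; apply: eq_bigr => x _.
  by rewrite mulrBr cz mulNr opprK.
rewrite detZ; congr (_ * _).
transitivity (char_poly (map_mx f A)).[z].
  rewrite -horner_evalE -det_map_mx; congr (\det _); apply/matrixP => i j.
  by rewrite !mxE /= /horner_eval !hornerE hornerMn hornerX.
rewrite -map_char_poly char_poly_spectrum // rmorph_prod horner_prod.
by apply: eq_bigr => x _; rewrite rmorphB /= map_polyX map_polyC !hornerE.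
Qed.

(** For real x, the squared modulus of 1 + i t x is 1 + t^2 x^2; this is why c
    is taken imaginary. *)
Lemma sqr_norm_matching_det (R : realType) (T : finType) (G : sgraph T)
    (t : R) :
  t != 0 ->
  `|matching_det (t *i)%C G [set: T]| ^+ 2 =
    (\prod_(x <- spectrum (adjmx R G)) (1 + t ^+ 2 * x ^+ 2))%:C%C.
Proof.
move=> t0.
have -> : matching_det (t *i)%C G [set: T] =
    \det (1%:M + (t *i)%C *: map_mx (real_complex R) (adjmx R G)).
  congr (\det _); apply/matrixP => i j; rewrite !mxE !inE /=.
  by rewrite rmorph_nat.
rewrite det_add1_spectrum ?adjmx_sym //; last first.
  by rewrite eq_complex /= negb_and t0 orbT.
rewrite normr_prod -prodrXl rmorph_prod /=; apply: eq_bigr => x _.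
rewrite -add_Re2_Im2; congr (_%:C)%C; rewrite /=; ring.
Qed.

Lemma prod_spectrum_le (R : realType) (T U : finType) (G : sgraph T)
    (H : sgraph U) (t : R) :
  t != 0 ->
  0 <= matching_det (t *i)%C G [set: T] <= matching_det (t *i)%C H [set: U] ->
  \prod_(x <- spectrum (adjmx R G)) (1 + t ^+ 2 * x ^+ 2)
    <= \prod_(x <- spectrum (adjmx R H)) (1 + t ^+ 2 * x ^+ 2).
Proof.
move=> t0 /andP[D1 D12]; rewrite -lecR -!sqr_norm_matching_det //.
have D2 := le_trans D1 D12; rewrite !ger0_norm //.
by rewrite ler_pXn2r // nnegrE.
Qed.


Lemma schatten_energyE (R : realType) (p : R) (T : finType) (G : sgraph T) :
  schatten_energy p G =
    \sum_(y <- [seq x ^+ 2 | x <- spectrum (adjmx R G)]) y `^ (p / 2).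
Proof.
rewrite /schatten_energy big_map; apply: eq_bigr => x _.
rewrite -real_normK ?num_real // -powR_mulrn ?normr_ge0 // -powRrM.
by rewrite mulrC divfK ?pnatr_eq0.
Qed.

(** Every w > 0 is the square of t = Num.sqrt w, so the hypothesis covers all
    the products that [power_sum_le] asks for. *)
Lemma schatten_energy_le (R : realType) (p : R) (T U : finType) (G : sgraph T)
    (H : sgraph U) :
  0 < p -> p < 2 ->
  (forall t : R, t != 0 -> 0 <= matching_det (t *i)%C G [set: T]
                           <= matching_det (t *i)%C H [set: U]) ->
  schatten_energy p G <= schatten_energy p H.
Proof.
move=> p0 p2 GH; rewrite !schatten_energyE; apply: power_sum_le.
- by rewrite divr_gt0.
- by rewrite ltr_pdivrMr // mul1r.
- by rewrite all_map; apply/allP => x _ /=; rewrite sqr_ge0.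
- by rewrite all_map; apply/allP => x _ /=; rewrite sqr_ge0.
move=> w w0; have t0 : Num.sqrt w != 0 by rewrite gt_eqF // sqrtr_gt0.
rewrite !big_map -(sqr_sqrtr (ltW w0)); exact: prod_spectrum_le (GH _ t0).
Qed.

Theorem theorem2 (R : realType) (n : nat) (T : finType) (G : sgraph T)
    (cardT : #|T| = n) (treeG : is_tree G) (p : R) (p_gt0 : 0 < p)
    (p_lt2 : p < 2) :
  schatten_energy p (star_graph n) <= schatten_energy p G
    <= schatten_energy p (path_graph n).
Proof.
have [T0 connG acycG] := treeG.
have sqr_le0 (t : R) : (t *i)%C ^+ 2 <= 0 :> R[i].
  have -> : (t *i)%C ^+ 2 = - (t ^+ 2)%:C%C.
    apply/eqP; rewrite eq_complex /= !expr2.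
    by apply/andP; split; apply/eqP; ring.
  by rewrite oppr_le0 ler0c sqr_ge0.
apply/andP; split; apply: schatten_energy_le => // t _.
  rewrite matching_det_star -?cardT //; apply/andP; split.
    by rewrite addr_ge0 ?ler01 // mulrn_wge0 // oppr_ge0.
  rewrite -cardsT; apply: matching_det_connected => //.
    exact: connected_in_setT.
  by rewrite -card_gt0 cardsT.
rewrite matching_det_path -cardT -cardsT.
have /andP[lb ->] := matching_det_forest [set: T] acycG (sqr_le0 t).
by rewrite (le_trans ler01).
Qed.
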